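(* For every odd integer $m \ge 5$ the graph $G_m$ is triangle-free, and for every even integer $m \ge 6$ the graph $H_m$ is triangle-free.
   Context: All graphs are finite and simple. A graph is triangle-free if it contains no cycle of length three. Let $m \ge 5$ be an integer and $n = 2m+1$. The graph $G_m$ is defined for $m$ odd and the graph $H_m$ for $m$ even. In both cases the vertex set consists of the $n$ distinct vertices $a_n$, $p_1,\dots,p_m$, $q_1,\dots,q_m$. All indices of $p$ and $q$ are taken modulo $m$ with representatives in $\{1,\dots,m\}$ (so $q_0 = q_m$, $p_{m+1}=p_1$, $q_{m+1} = q_1$, etc.). The (undirected) edges are: (1) $a_n q_i$ for $1 \le i \le m$; (2) $p_i p_{i+1}$ for $1 \le i \le m$; (3) for $G_m$ ($m$ odd): $p_i q_{i+(2k-1)}$ for $1 \le i \le m$ and all integers $k$ with $0 \le k \le \frac{m-3}{2}$; for $H_m$ ($m$ even): $p_i q_{i+(2k-1)}$ for $1 \le i \le m$ and all integers $k$ with $0 \le k \le \frac{m-2}{2}$. There are no other edges. *)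

(* Defs.v *)
From HB Require Import structures.
From mathcomp Require Import all_boot all_order all_algebra.

Set Implicit Arguments.
Unset Strict Implicit.
Unset Printing Implicit Defensive.

Record sgraph := SGraph {
  svertex : finType;
  sedge : rel svertex;
  sedge_sym : symmetric sedge;
  sedge_irrefl : irreflexive sedge }.

Definition triangle_free (G : sgraph) : Prop :=
  forall c : seq (svertex G), size c = 3 -> ~ ucycle (@sedge G) c.

(* An index in {1, ..., m} taken modulo m is represented by its residue in    *)
(* 'I_m = {0, ..., m - 1}; thus p_m and q_m are the vertices with residue 0.  *)
Inductive vertex (m : nat) : predArgType :=
  | vert_a
  | vert_p of 'I_m
  | vert_q of 'I_m.

Arguments vert_a {m}.

Definition vertex_code m (v : vertex m) : option ('I_m + 'I_m) :=
  match v with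
  | vert_a => None
  | vert_p i => Some (inl i)
  | vert_q i => Some (inr i)
  end.

Definition vertex_decode m (c : option ('I_m + 'I_m)) : vertex m :=
  match c with
  | None => vert_a
  | Some (inl i) => vert_p i
  | Some (inr i) => vert_q i
  end.

Lemma vertex_codeK m : cancel (@vertex_code m) (@vertex_decode m).
Proof. by case. Qed.

Lemma vertex_decodeK m : cancel (@vertex_decode m) (@vertex_code m).
Proof. by case=> [[]|]. Qed.

HB.instance Definition _ (m : nat) :=
  Finite.copy (vertex m) (can_type (@vertex_codeK m)).

Lemma card_vertex m : #|vertex m| = m.*2.+1.
Proof.
have bij : bijective (@vertex_code m).
  exact: Bijective (@vertex_codeK m) (@vertex_decodeK m).
by rewrite (bij_eq_card bij) card_option card_sum !card_ord addnn.
Qed.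

(* Each edge in one orientation: a q_i, p_i p_(i+1), and p_i q_(i+2k-1) for   *)
(* 0 <= k <= K. The last index may be negative, hence the congruence in int.  *)
Definition oriented_edge (m K : nat) (x y : vertex m) : bool :=
  match x, y with
  | vert_a, vert_q _ => true
  | vert_p i, vert_p j => j == i + 1 %[mod m]
  | vert_p i, vert_q j =>
      [exists k : 'I_K.+1, (j%:Z == i%:Z + (2 * k%:Z - 1) %[mod m%:Z])%Z]
  | _, _ => false
  end.

Definition adj (m K : nat) : rel (vertex m) :=
  fun x y => oriented_edge K x y || oriented_edge K y x.

Lemma adj_sym m K : symmetric (@adj m K).
Proof. by move=> x y; rewrite /adj orbC. Qed.

Lemma adj_irrefl m K : 5 <= m -> irreflexive (@adj m K).
Proof.
move=> hm [|i|i] //; rewrite /adj orbb /=.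
rewrite -[X in X == _ %[mod _]]addn0 eqn_modDl mod0n.
by rewrite modn_small // (leq_trans _ hm).
Qed.

Definition G_graph (m : nat) (hm : 5 <= m) : sgraph :=
  SGraph (@adj_sym m ((m - 3) %/ 2)) (adj_irrefl ((m - 3) %/ 2) hm).

Definition H_graph (m : nat) (hm : 5 <= m) : sgraph :=
  SGraph (@adj_sym m ((m - 2) %/ 2)) (adj_irrefl ((m - 2) %/ 2) hm).

(* Main.v *)
Require Import Defs.
From mathcomp Require Import all_boot all_order all_algebra.
From mathcomp Require Import zify ring.

(** Give an edge [p_i p_j] the displacement [j - i], which is [1] or [-1]
    modulo [m], and an edge [p_i q_j] the displacement [j - i], which is
    [2k - 1] modulo [m] for some [0 <= k <= K].  These representatives
    [1], [-1] and [2k - 1] are all odd.  Since [a] is adjacent only to the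
    vertices [q_i], and no two of the [q_i] are adjacent, a triangle is either [p p p] or [p p q].  Going around
    it, the signed representatives add up to an integer that is odd, being a sum
    of three odd integers, and that is divisible by [m], because the walk is
    closed.

    In a triangle [p p p] this sum has absolute value at most [3 < m], so it is
    not a multiple of [m] ([no_ppp]).  In a triangle [p p q] it has absolute
    value at most [2K + 1] ([no_ppq]).  For [m] odd, [2K + 1 = m - 2 < m] and
    the same argument applies; for [m] even, no odd integer at all is a multiple
    of [m].  Both reasons are combined in [odd_ndvdz]. *)

Set Implicit Arguments.
Unset Strict Implicit.

Import GRing.Theory.
Local Open Scope ring_scope.

Lemma odd_ndvdz (m : nat) (t : int) :
  ~~ odd m \/ (`|(2 * t + 1)%R| < m)%N -> ~~ (m%:Z %| 2 * t + 1)%Z.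
Proof.
move=> hm; apply/negP=> /dvdzP[c def_c].
case: hm => [m_even | small].
  have def_m : m = (m./2).*2 by rewrite even_halfK.
  have : 2 * t + 1 = 2 * (c * (m./2)%:Z).
    by rewrite def_c {1}def_m -muln2 PoszM; ring.
  lia.
have [c0 | c_neq0] := eqVneq c 0; first by rewrite c0 mul0r in def_c; lia.
move: small; rewrite def_c abszM; have : (0 < `|c|)%N by rewrite absz_gt0.
nia.
Qed.

Lemma adj_ppP (m K : nat) (i j : 'I_m) :
  adj K (vert_p i) (vert_p j) ->
  exists2 s : int, s = 1 \/ s = -1 & (m%:Z %| j%:Z - i%:Z - s)%Z.
Proof.
have succ_dvd (u v : 'I_m) :
    v == u + 1 %[mod m] -> (m%:Z %| v%:Z - u%:Z - 1)%Z.
  move=> uv; have : (v%:Z == (u + 1)%N%:Z %[mod m%:Z])%Z by rewrite !modz_nat.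
  by rewrite eqz_mod_dvd PoszD opprD addrA.
case/orP=> /= /succ_dvd dvd_m; first by exists 1; [left|].
exists (-1); first by right.
have -> : j%:Z - i%:Z - (-1) = - (i%:Z - j%:Z - 1) by ring.
by rewrite rpredN.
Qed.

Lemma adj_pqP (m K : nat) (i j : 'I_m) :
  adj K (vert_p i) (vert_q j) ->
  exists2 k : nat, (k <= K)%N & (m%:Z %| j%:Z - i%:Z - (2 * k%:Z - 1))%Z.
Proof.
rewrite /adj /= orbF => /existsP[k]; rewrite eqz_mod_dvd opprD addrA => hk.
by exists k; first exact: ltn_ord k.
Qed.

(** The displacements of the three sides are all [1] or [-1], so their sum is
    one of [-3], [-1], [1], [3]. *)
Lemma no_ppp (m K : nat) (i j h : 'I_m) : (3 < m)%N ->
  adj K (vert_p i) (vert_p j) -> adj K (vert_p j) (vert_p h) ->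
  adj K (vert_p h) (vert_p i) -> False.
Proof.
move=> m_gt3 /adj_ppP[s1 hs1 d1] /adj_ppP[s2 hs2 d2] /adj_ppP[s3 hs3 d3].
have [t def_t] : exists t : int, s1 + s2 + s3 = 2 * t + 1.
  by case: hs1 hs2 hs3 => -> [] -> [] ->;
    [exists 1|exists 0|exists 0|exists (-1)|exists 0|exists (-1)|exists (-1)
    |exists (-2)].
have /negP[] : ~~ (m%:Z %| 2 * t + 1)%Z by apply: odd_ndvdz; right; lia.
rewrite -def_t.
have -> : s1 + s2 + s3 = - ((j%:Z - i%:Z - s1) + (h%:Z - j%:Z - s2)
                            + (i%:Z - h%:Z - s3)) by ring.
by rewrite rpredN; exact: rpredD (rpredD d1 d2) d3.
Qed.

(** If [p_i p_j] has displacement [s] and the edges to the common neighbour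
    [q_h] have displacements [2k - 1] and [2l - 1], then [m] divides
    [s + 2(l - k)]. *)
Lemma no_ppq (m K : nat) (i j h : 'I_m) : ~~ odd m \/ (K.*2.+1 < m)%N ->
  adj K (vert_p i) (vert_p j) -> adj K (vert_p i) (vert_q h) ->
  adj K (vert_p j) (vert_q h) -> False.
Proof.
move=> hm /adj_ppP[s hs ds] /adj_pqP[k hk dk] /adj_pqP[l hl dl].
have [t def_t] : exists t : int, s + 2 * (l%:Z - k%:Z) = 2 * t + 1.
  by case: hs => ->; [exists (l%:Z - k%:Z)|exists (l%:Z - k%:Z - 1)]; ring.
have /negP[] : ~~ (m%:Z %| 2 * t + 1)%Z.
  by apply: odd_ndvdz; case: hm => hm; [left|right; lia].
rewrite -def_t.
have -> : s + 2 * (l%:Z - k%:Z) =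
    (h%:Z - i%:Z - (2 * k%:Z - 1)) - (h%:Z - j%:Z - (2 * l%:Z - 1))
    - (j%:Z - i%:Z - s) by ring.
exact: rpredB (rpredB dk dl) ds.
Qed.

Lemma adj_no_triangle (m K : nat) (x y z : vertex m) : (3 < m)%N ->
  ~~ odd m \/ (K.*2.+1 < m)%N ->
  adj K x y -> adj K y z -> adj K z x -> False.
Proof.
move=> m_gt3 hm; case: x y z => [|i|i] [|j|j] [|h|h] // xy yz zx.
- exact: no_ppp xy yz zx.
- by apply: no_ppq hm xy _ yz; rewrite adj_sym.
- by apply: no_ppq hm zx _ xy; rewrite adj_sym.
- by apply: no_ppq hm yz _ zx; rewrite adj_sym.
Qed.

Lemma triangle_freeW (G : sgraph) :
  (forall x y z : svertex G,
     sedge x y -> sedge y z -> sedge z x -> False) -> triangle_free G.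
Proof.
move=> noT [|x [|y [|z []]]] // _ /andP[/= /and4P[xy yz zx _] _].
exact: noT xy yz zx.
Qed.

Local Close Scope ring_scope.

Theorem lemma4p3 :
  (forall (m : nat) (hm : 5 <= m), odd m -> triangle_free (G_graph hm)) /\
  (forall (m : nat) (hm : 6 <= m), ~~ odd m -> triangle_free (H_graph (ltnW hm))).
Proof.
split=> m hm m_parity; apply: triangle_freeW => x y z.
  by apply: adj_no_triangle; [|right]; lia.
by apply: adj_no_triangle; [lia|left].
Qed.
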